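(* Let $\mu$ be a quasi-definite complex Borel measure on $\mathbb{T}^D$ and let $\mathcal D_\mu$ be the Reinhardt domain of convergence of the Laurent series $\hat\mu(z)$. Then the second kind functions $\mathcal C,\hat{\mathcal C}$ can be written as $$\mathcal C(z)=(2\pi)^D (H^\dagger)^{-1}\hat\Phi(z)\,\bar{\hat\mu}(z^{-1})\quad\text{for } z^{-1}\in\mathcal D_\mu,\qquad \hat{\mathcal C}(z)=(2\pi)^D H^{-1}\Phi(z)\,\hat\mu(z)\quad\text{for } z\in\mathcal D_\mu .$$
   Context: Let $D\ge1$, $z(\theta)=(e^{i\theta_1},\dots,e^{i\theta_D})$. For $\alpha\in\mathbb{Z}^D$ put $|\alpha|=\sum_a|\alpha_a|$, $z^\alpha=\prod_a z_a^{\alpha_a}$, $[k]=\{\alpha:|\alpha|=k\}$. Multi-indices are ordered by longitude $|\alpha|$ and lexicographically inside each $[k]$; $\chi(z)$ is the semi-infinite column vector of all monomials $z^\alpha$ in this order, with blocks $\chi_{[k]}$. Semi-infinite matrices have the corresponding block structure and $A^{[k]}$ denotes truncation to blocks $0,\dots,k-1$. The moment matrix is $G=\oint_{\mathbb{T}^D}\chi(z(\theta))d\mu(\theta)\chi(z(\theta))^\dagger$. The measure is quasi-definite if $\det G^{[k]}\ne0$ for all $k\ge1$; then uniquely $G=S^{-1}H(\hat S^{-1})^\dagger$ with $S,\hat S$ block lower unitriangular and $H$ block diagonal with invertible blocks. Put $\Phi=S\chi$, $\hat\Phi=\hat S\chi$. The second kind functions are $\mathcal C(z)=(S^{-1})^\dagger\chi(z)$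 and $\hat{\mathcal C}(z)=(\hat S^{-1})^\dagger\chi(z)$ (each entry is a Laurent series in $z$). The Fourier coefficients of $\mu$ are $c_\alpha=\frac1{(2\pi)^D}\oint e^{-i\alpha\cdot\theta}d\mu(\theta)$, and $\hat\mu(z)=\sum_{\alpha\in\mathbb{Z}^D}c_\alpha z^\alpha$, whose (open) domain of absolute convergence in $(\mathbb{C}^* )^D$ is $\mathcal D_\mu$. Moreover $\bar{\hat\mu}(z)=\sum_\alpha \overline{c_\alpha}z^\alpha$, and $z^{-1}=(z_1^{-1},\dots,z_D^{-1})$. *)

(* Defs.v *)
From HB Require Import structures.
From mathcomp Require Import all_boot all_order all_algebra.
From mathcomp Require Import spectral finmap.
From mathcomp Require Import all_classical all_reals all_analysis.
From mathcomp Require Import zify.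
From mathcomp Require summability.
From mathcomp Require Import complex.

Set Implicit Arguments.
Unset Strict Implicit.
Unset Printing Implicit Defensive.

Import Order.TTheory GRing.Theory Num.Theory.
Import numFieldNormedType.Exports.

Local Open Scope classical_set_scope.
Local Open Scope complex_scope.
Local Open Scope ring_scope.
Local Open Scope sesquilinear_scope.

(* The topology of the complex numbers R[i] is the one given by their norm. *)
HB.instance Definition _ (R : realType) := NormedModule.copy R[i] (R[i]^o).

Section ComplexMeasure.
Context d (T : measurableType d) (R : realType).

Record complex_measure := ComplexMeasure {
  cm_fun :> set T -> R[i];
  cm_fun0 : cm_fun set0 = 0;
  cm_fun_sigma_additive : forall F : (set T)^nat,
    (forall n, measurable (F n)) -> trivIset setT F ->
    (fun n => \sum_(0 <= i < n) cm_fun (F i)) @ \oo --> cm_fun (\bigcup_n F n) }.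

Implicit Type nu : complex_measure.

Definition cm_Re nu (A : set T) : \bar R := (complex.Re (nu A))%:E.
Definition cm_Im nu (A : set T) : \bar R := (complex.Im (nu A))%:E.

Lemma cvg_contract_complex (g : {additive R[i] -> R}) :
  (forall x, `|g x|%:C <= `|x|) ->
  forall (u : R[i]^nat) l, u @ \oo --> l -> (g \o u) @ \oo --> g l.
Proof.
move=> gle u l ul; apply/cvgrPdist_lt => e e0.
have eC0 : 0 < e%:C :> R[i] by rewrite ltcR.
move/cvgrPdist_lt : ul => /(_ _ eC0); apply: filterS => n /= ule.
by rewrite -raddfB -ltcR (le_lt_trans (gle _)).
Qed.

Lemma cm_Re_charge0 nu : cm_Re nu set0 = 0%E.
Proof. by rewrite /cm_Re cm_fun0. Qed.

Lemma cm_Im_charge0 nu : cm_Im nu set0 = 0%E.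
Proof. by rewrite /cm_Im cm_fun0. Qed.

Lemma cm_Re_fin nu A : measurable A -> cm_Re nu A \is a fin_num.
Proof. by []. Qed.

Lemma cm_Im_fin nu A : measurable A -> cm_Im nu A \is a fin_num.
Proof. by []. Qed.

Lemma cm_Re_sigma nu : semi_sigma_additive (cm_Re nu).
Proof.
move=> F mF tF _; rewrite /cm_Re.
under eq_fun do rewrite sumEFin -raddf_sum.
apply: cvg_EFin; first exact: nearW.
apply: (cvg_contract_complex (g := @complex.Re R)) (cm_fun_sigma_additive mF tF).
exact: normc_ge_Re.
Qed.

Lemma cm_Im_sigma nu : semi_sigma_additive (cm_Im nu).
Proof.
move=> F mF tF _; rewrite /cm_Im.
under eq_fun do rewrite sumEFin -raddf_sum.
apply: cvg_EFin; first exact: nearW.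
apply: (cvg_contract_complex (g := @complex.Im R)) (cm_fun_sigma_additive mF tF).
move=> [x y] /=; rewrite normc_def /= lecR -sqrtr_sqr.
by rewrite ler_wsqrtr// lerDr sqr_ge0.
Qed.

HB.instance Definition _ nu := isCharge.Build _ T R (cm_Re nu)
  (cm_Re_charge0 nu) (@cm_Re_fin nu) (@cm_Re_sigma nu).
HB.instance Definition _ nu := isCharge.Build _ T R (cm_Im nu)
  (cm_Im_charge0 nu) (@cm_Im_fin nu) (@cm_Im_sigma nu).

(* Integral against a finite signed measure, through a Jordan decomposition
   (all Hahn decompositions yield the same Jordan decomposition). *)
Definition charge_int (nu : {charge set T -> \bar R}) (f : T -> R) : R :=
  let nuPN := svalP (cid (svalP (cid (Hahn_decomposition nu)))) in
  Rintegral (jordan_pos nuPN) setT f - Rintegral (jordan_neg nuPN) setT f.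

Definition cm_int (nu : complex_measure) (f : T -> R[i]) : R[i] :=
  let re x := complex.Re (f x) in
  let im x := complex.Im (f x) in
  (charge_int (cm_Re nu) re - charge_int (cm_Im nu) im) +i*
  (charge_int (cm_Re nu) im + charge_int (cm_Im nu) re).

End ComplexMeasure.

Section Series.
Context (R : realType) (I : choiceType).

Definition abs_summable (f : I -> R[i]) : Prop :=
  summable [set: I] (fun i => (ComplexField.Normc.normc (f i))%:E).

(* The limit of the finite partial sums along the directed set of finite
   subsets of I; meaningful when f is abs_summable. *)
Definition series_sum (f : I -> R[i]) : R[i] := summability.sum f.

End Series.

Section MultiIndices.
Variable D : nat.

Definition longitude (al : D.-tuple int) : nat :=
  (\sum_(a < D) `|tnth al a|%N)%N.

(* The entries of a multi-index of longitude k lie between -k and k. *)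
Definition idx_box (k : nat) : seq (D.-tuple int) :=
  [seq map_tuple (fun j : 'I_k.*2.+1 => (j : nat)%:Z - k%:Z) t
     | t <- enum {: D.-tuple 'I_k.*2.+1}].

(* The multi-indices of longitude k in lexicographic order (see mem_block). *)
Definition block (k : nat) : seq (D.-tuple int) :=
  sort (fun al be : D.-tuplelexi int => (al <= be)%O)
    [seq al <- idx_box k | longitude al == k].

Definition bsize (k : nat) : nat := size (block k).

Definition bidx (k : nat) (i : 'I_(bsize k)) : D.-tuple int :=
  tnth (in_tuple (block k)) i.

Lemma mem_block k al : (al \in block k) = (longitude al == k).
Proof.
rewrite mem_sort mem_filter andb_idr// => /eqP alk.
have bnd a : (`|tnth al a| <= k)%N.
  by rewrite -alk /longitude (bigD1 a)//= leq_addr.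
apply/mapP; exists [tuple inord (absz (tnth al a + k%:Z)) | a < D].
  by rewrite mem_enum.
apply: eq_from_tnth => a; rewrite !(tnth_map, tnth_ord_tuple) inordK.
  by have := bnd a; lia.
by have := bnd a; lia.
Qed.

Lemma uniq_block k : uniq (block k).
Proof.
rewrite sort_uniq filter_uniq// map_inj_uniq ?enum_uniq// => s t st.
apply: eq_from_tnth => a.
have := congr1 (fun u => tnth u a) st.
by rewrite !tnth_map => /addIr[] /val_inj.
Qed.

End MultiIndices.

Section SemiInfinite.
Context (R : realType) (D : nat).

(* Semi-infinite vectors and matrices, given by their blocks. *)
Definition bvec : Type := forall k, 'cV[R[i]]_(bsize D k).
Definition bmx : Type := forall k l, 'M[R[i]]_(bsize D k, bsize D l).

Implicit Types (A B : bmx) (v : bvec).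

Definition truncmx A (n : nat) := \mxblock_(k < n, l < n) A k l.

Definition bmx1 : bmx :=
  fun k l => \matrix_(i, j) ((k == l) && (nat_of_ord i == j))%:R.

Definition badj A : bmx := fun k l => (A l k)^t*.

Definition block_lower A : Prop := forall k l, (k < l)%N -> A k l = 0.

Definition block_unilower A : Prop :=
  block_lower A /\ forall k, A k k = 1%:M.

Definition block_diagonal A : Prop := forall k l, k != l -> A k l = 0.

(* A *m B and A *m v for a block lower triangular A: the sums stop at j = k. *)
Definition lowermul A B : bmx := fun k l => \sum_(j < k.+1) A k j *m B j l.
Definition lowermulv A v : bvec := fun k => \sum_(j < k.+1) A k j *m v j.

Definition lower_inverse A B : Prop :=
  [/\ block_lower B,
      forall k l, lowermul A B k l = bmx1 k l &
      forall k l, lowermul B A k l = bmx1 k l].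

(* A *m v for an arbitrary A: each entry is a series, indexed by the pairs
   (block l, position in the block l). *)
Definition mulv_term A v k (i : 'I_(bsize D k)) (p : {l : nat & 'I_(bsize D l)})
  : R[i] := A k (tag p) i (tagged p) * v (tag p) (tagged p) 0.
Definition mulv_converges A v : Prop :=
  forall k i, abs_summable (@mulv_term A v k i).
Definition mulv A v : bvec := fun k => \col_i series_sum (@mulv_term A v k i).

End SemiInfinite.

Section Torus.
Context (R : realType) (D : nat).

Definition torus_set : set 'rV[R[i]]_D := [set z | forall a, `|z 0 a| = 1].

Lemma torus_one : set_type torus_set.
Proof. by exists (const_mx 1); apply/mem_set => a; rewrite mxE normr1. Qed.

HB.instance Definition _ := isPointed.Build (set_type torus_set) torus_one.

(* The torus with its Borel sigma-algebra; its points are the z(theta). *)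
Definition torus := g_sigma_algebraType (@open (set_type torus_set)).

Definition torus_val (t : torus) : 'rV[R[i]]_D := set_val t.

Definition monomial (al : D.-tuple int) (z : 'rV[R[i]]_D) : R[i] :=
  \prod_(a < D) z 0 a ^ tnth al a.

Definition zinv (z : 'rV[R[i]]_D) : 'rV[R[i]]_D := map_mx GRing.inv z.

Definition chi (z : 'rV[R[i]]_D) : bvec R D :=
  fun k => \col_i monomial (bidx i) z.

Variable mu : complex_measure torus R.

Definition moment : bmx R D := fun k l => \matrix_(i, j)
  cm_int mu (fun t => (chi (torus_val t) k *m (chi (torus_val t) l)^t*) i j).

Definition quasi_definite : Prop :=
  forall n, (0 < n)%N -> \det (truncmx moment n) != 0.

(* At z = z(theta), e^{-i al.theta} is (z^-1)^al. *)
Definition fourier (al : D.-tuple int) : R[i] :=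
  ((2 * pi)%:C ^+ D)^-1 *
  cm_int mu (fun t => monomial al (zinv (torus_val t))).

Definition muhat (z : 'rV[R[i]]_D) : R[i] :=
  series_sum (fun al => fourier al * monomial al z).

Definition muhat_conj (z : 'rV[R[i]]_D) : R[i] :=
  series_sum (fun al => (fourier al)^* * monomial al z).

(* The domain of convergence is an open set: the interior of the set of points
   of absolute convergence. *)
Definition conv_domain : set 'rV[R[i]]_D :=
  interior [set z : 'rV[R[i]]_D | (forall a, z 0 a != 0) /\
                    abs_summable (fun al => fourier al * monomial al z)].

(* G = S^-1 *m H *m (Sh^-1)^t*, where Si = S^-1 and Shi = Sh^-1 *)
Definition gauss_borel (S Si H Sh Shi : bmx R D) : Prop :=
  [/\ block_unilower S /\ lower_inverse S Si,
      block_unilower Sh /\ lower_inverse Sh Shi,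
      block_diagonal H /\ (forall k, H k k \in unitmx) &
      forall k l, moment k l = lowermul Si (lowermul H (badj Shi)) k l].

End Torus.

(* Main.v *)
(* Multiplying G = S^-1 H (Sh^-1)^* on the left by H^-1 S gives
   (Sh^-1)^* = H^-1 S G, where the product by the lower triangular S is a finite
   sum; likewise (S^-1)^* = (H^-1)^* Sh G^*.  So the second kind functions are
   finite combinations of the rows of G chi(z) and G^* chi(z).  Since
   G_(al, be) = (2 pi)^D c_(be - al), the shift be |-> be - al turns the row al
   of G chi(z) into (2 pi)^D z^al muhat(z); for G^* the reflection
   be |-> al - be plays this role. *)
Require Import Defs.
From mathcomp Require Import all_boot all_order all_algebra.
From mathcomp Require Import spectral finmap.
From mathcomp Require Import all_classical all_reals all_analysis.
From mathcomp Require Import complex.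
From mathcomp Require Import ring.
From mathcomp Require summability.

Import Order.TTheory GRing.Theory Num.Theory.
Import numFieldNormedType.Exports.

Local Open Scope classical_set_scope.
Local Open Scope complex_scope.
Local Open Scope ring_scope.
Local Open Scope sesquilinear_scope.

(* Unconditional sums of absolutely summable complex families *)
#[local] Existing Instance summability.totally_filter.

Lemma partial_sumE {I : choiceType} {V : zmodType} (f : I -> V) (A : {fset I}) :
  summability.partial_sum f A = \sum_(i <- A) f i.
Proof. by rewrite big_seq_fsetE. Qed.

Section SummableFamilies.
Context {R : realType} {I : choiceType}.
Local Notation normc := (@ComplexField.Normc.normc R).
Implicit Types (f g : I -> R[i]) (h : I -> R).

(** An extended sum of nonnegative terms is the supremum of its finite partial sums. A uniform bound
    on these is easy to carry through sums, scalings and reindexing. *)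
Lemma abs_summableP f : abs_summable f <->
  exists M : R, forall A : {fset I},
    \sum_(i <- A) normc (f i) <= M.
Proof.
have n0 i : 0 <= normc (f i) by case: (f i) => a b; exact: sqrtr_ge0.
rewrite /abs_summable /summable.
under eq_esum do rewrite gee0_abs ?lee_fin ?n0//.
split=> [fS|[M fM]]; last first.
  apply: (@le_lt_trans _ _ M%:E); last exact: ltry.
  apply: ge_ereal_sup => _ [A [/finite_fsetP[X ->] _] <-].
  by rewrite -fsbig_seq ?fset_uniq// sumEFin lee_fin.
exists (fine (\esum_(i in [set: I]) (normc (f i))%:E)) => A.
rewrite -lee_fin fineK; last first.
  by rewrite ge0_fin_numE// esum_ge0// => i _; rewrite lee_fin.
apply: esum_ge; exists [set` A]; first by split.
by rewrite -fsbig_seq ?fset_uniq// sumEFin.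
Qed.

(** Finite partial sums grow with the finite set, so they tend to their supremum. *)
Lemma cvg_partial_sum_nonneg h : (forall i, 0 <= h i) ->
  (exists M : R, forall A : {fset I}, \sum_(i <- A) h i <= M) ->
  exists l : R, summability.partial_sum h @ summability.totally --> l.
Proof.
move=> h0 [M hM].
pose E := [set \sum_(i <- A) h i | A in [set: {fset I}]].
have supE : has_sup E.
  split; first by exists (\sum_(i <- fset0) h i), fset0.
  by exists M => _ [A _ <-].
exists (sup E); apply/cvgrPdist_lt => e e0.
have [_ [A _ <-] EA] := sup_adherent e0 supE.
exists A => // B /= AB; rewrite partial_sumE.
have BE : \sum_(i <- B) h i <= sup E by apply: sup_upper_bound => //; exists B.
have AleB : \sum_(i <- A) h i <= \sum_(i <- B) h i.
  rewrite [leRHS](big_fsetID _ (mem A)) /=.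
  rewrite (_ : [fset x in B | x \in A]%fset = A) ?lerDl ?sumr_ge0//.
  by apply/fsetP => x; rewrite !inE/=; apply: andb_idl => /(fsubsetP AB).
by rewrite ger0_norm ?subr_ge0// ltrBlDr addrC -ltrBlDr (lt_le_trans EA).
Qed.

(** Write [h] as [(|h| + h) - |h|], a difference of nonnegative families with bounded partial
    sums. *)
Lemma cvg_partial_sum_real h :
  (exists M : R, forall A : {fset I}, \sum_(i <- A) `|h i| <= M) ->
  exists l : R, summability.partial_sum h @ summability.totally --> l.
Proof.
move=> [M hM].
have [||l2 hl2] := @cvg_partial_sum_nonneg (fun i => `|h i|).
- by move=> i; exact: normr_ge0.
- by exists M.
have [i||l1 hl1] := @cvg_partial_sum_nonneg (fun i => `|h i| + h i).
- by rewrite -lerBlDl sub0r lerNl -normrN ler_norm.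
- exists (M + M) => A; rewrite big_split/= lerD// (le_trans _ (hM A))//.
  by apply: ler_sum => i _; exact: ler_norm.
exists (l1 - l2); apply: cvg_trans (cvgB hl1 hl2).
apply: near_eq_cvg; apply: nearW => A.
rewrite /summability.partial_sum /= !fctE.
by rewrite -sumrB; apply: eq_bigr => i _; rewrite addrC addKr.
Qed.

Lemma cvg_partial_sum_complex f : abs_summable f ->
  exists l : R[i], summability.partial_sum f @ summability.totally --> l.
Proof.
move=> /abs_summableP[M fM].
have normcE i : `|f i| = (normc (f i))%:C by [].
have [|a fa] := @cvg_partial_sum_real (fun i => complex.Re (f i)).
  exists M => A; rewrite (le_trans _ (fM A))//; apply: ler_sum => i _.
  by rewrite -lecR -normcE normc_ge_Re.
have [|b fb] := @cvg_partial_sum_real (fun i => complex.Im (f i)).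
  exists M => A; rewrite (le_trans _ (fM A))//; apply: ler_sum => i _.
  case: (f i) => x y /=.
  by rewrite -sqrtr_sqr ler_wsqrtr// lerDr sqr_ge0.
exists (a +i* b); apply/cvgrPdist_lt => e e0.
(* In the order of [R[i]] a positive element is real, so half of [e] can bound each of the real and
   imaginary errors. *)
have [r r0 ->] : exists2 r : R, 0 < r & e = r%:C.
  move: e0; case: e => x y; rewrite ltcE/= => /andP[/eqP y0 x0].
  by exists x; rewrite // y0.
have r2 : 0 < r / 2 by rewrite divr_gt0.
move/cvgrPdist_lt : fa => /(_ _ r2); move/cvgrPdist_lt : fb => /(_ _ r2).
apply: filterS2 => A bA aA.
have -> : a +i* b - summability.partial_sum f A =
    (a - summability.partial_sum (fun i => complex.Re (f i)) A)%:C +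
    'i * (b - summability.partial_sum (fun i => complex.Im (f i)) A)%:C.
  rewrite [LHS]complexE !raddfB/= /summability.partial_sum.
  by rewrite (raddf_sum (@complex.Re R)) (raddf_sum (@complex.Im R)) complexiE.
rewrite (le_lt_trans (ler_normD _ _))// normrM.
have nR (x : R) : `|x%:C| = `|x|%:C :> R[i] by rewrite normc_def/= expr0n addr0 sqrtr_sqr.
by rewrite normCi mul1r !nR -rmorphD/= ltcR (splitr r) ltrD.
Qed.

(** [series_sum] is a limit operator that says nothing by itself about convergence. This relation
    carries summability and value together through all manipulations of series. *)
Definition abs_sum f (l : R[i]) :=
  abs_summable f /\ summability.partial_sum f @ summability.totally --> l.

Lemma abs_sum_series f l : abs_sum f l -> series_sum f = l.
Proof.
case=> _ fl; have := @summability.totally_filter I.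
by move=> ?; apply: cvg_lim.
Qed.

Lemma abs_summable_abs_sum f : abs_summable f -> abs_sum f (series_sum f).
Proof.
move=> fS; have [l fl] := cvg_partial_sum_complex f fS.
by rewrite (@abs_sum_series f l).
Qed.

Lemma abs_sum0 : abs_sum (fun _ => 0) 0.
Proof.
split.
  apply/abs_summableP; exists 0 => A.
  by rewrite big1// => i _; exact: ComplexField.Normc.normc0.
apply: cvg_near_cst; apply: nearW => A.
by rewrite /summability.partial_sum big1.
Qed.

Lemma abs_sumD f g lf lg : abs_sum f lf -> abs_sum g lg ->
  abs_sum (fun i => f i + g i) (lf + lg).
Proof.
case=> /abs_summableP[M fM] fl [/abs_summableP[N gN] gl]; split.
  apply/abs_summableP; exists (M + N) => A.
  rewrite (le_trans _ (lerD (fM A) (gN A)))// -big_split/=.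
  by apply: ler_sum => i _; exact: le_normcD.
apply: cvg_trans (cvgD fl gl); apply: near_eq_cvg.
apply: nearW => A; rewrite !fctE.
by rewrite /summability.partial_sum /= -big_split.
Qed.

Lemma abs_sumZ f l (a : R[i]) :
  abs_sum f l -> abs_sum (fun i => a * f i) (a * l).
Proof.
case=> /abs_summableP[M fM] fl; split.
  apply/abs_summableP; exists (normc a * M) => A.
  under eq_bigr do rewrite ComplexField.Normc.normcM.
  rewrite -mulr_sumr ler_wpM2l//; case: (a) => x y; exact: sqrtr_ge0.
apply: cvg_trans (@cvgZl_tmp _ _ _ _ _ a _ _ fl); apply: near_eq_cvg.
apply: nearW => A.
by rewrite /summability.partial_sum /= scaler_sumr.
Qed.

Lemma abs_sum_sum (J : finType) (f : J -> I -> R[i]) (l : J -> R[i]) :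
  (forall j, abs_sum (f j) (l j)) ->
  abs_sum (fun i => \sum_j f j i) (\sum_j l j).
Proof.
move=> fl; elim: (index_enum J) => [|j s IH].
  rewrite big_nil (_ : (fun _ => _) = fun=> 0); first exact: abs_sum0.
  by apply/funext => i; rewrite big_nil.
rewrite big_cons (_ : (fun _ => _) = fun i => f j i + \sum_(k <- s) f k i).
  exact: abs_sumD (fl j) IH.
by apply/funext => i; rewrite big_cons.
Qed.

End SummableFamilies.

Lemma abs_sum_reindex {R : realType} {I J : choiceType} (e : J -> I)
    (f : I -> R[i]) l :
  bijective e -> abs_sum f l -> abs_sum (f \o e) l.
Proof.
move=> [e' eK e'K] [/abs_summableP[M fM] fl].
have reE (V : zmodType) (h : I -> V) (A : {fset J}) :
    \sum_(j <- A) h (e j) = \sum_(i <- (e @` A)%fset) h i.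
  by rewrite big_imfset//= => x y _ _; exact: can_inj eK _ _.
split.
  apply/abs_summableP; exists M => A.
  by rewrite (reE _ (fun i => ComplexField.Normc.normc (f i))).
(* If the partial sums over sets containing [A] lie in [U], so do the reindexed ones over sets
   containing the preimage of [A] under [e]. *)
move=> U /fl[A _ AU]; exists (e' @` A)%fset => // B /= /fsubsetP AB.
have := AU (e @` B)%fset; rewrite /= !partial_sumE -reE; apply; apply/fsubsetP => x xA.
by apply/imfsetP; exists (e' x); rewrite ?e'K// AB// in_imfset.
Qed.

(** * Products and adjoints of block triangular matrices *)

Section BlockMatrices.
Context {R : realType} {D : nat}.
Implicit Types A B H X G : bmx R D.

Lemma big_ord_lower {V : zmodType} (F : nat -> V) {m n} : (m <= n)%N ->
  (forall j, (m < j)%N -> F j = 0) -> \sum_(j < n.+1) F j = \sum_(j < m.+1) F j.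
Proof.
move=> mn F0; rewrite (@big_ord_widen _ _ _ m.+1 n.+1 F) ?ltnS//.
rewrite [RHS]big_mkcond/=; apply: eq_bigr => j _.
by case: ifPn => //; rewrite -leqNgt => /F0.
Qed.

Lemma lowermulK {A B} X k l : lower_inverse A B ->
  lowermul A (lowermul B X) k l = X k l.
Proof.
case=> Blow AB _; rewrite /lowermul.
(* Associativity: since [B] is lower triangular, the inner sum over [m <= j] extends to [m <= k],
   and the two finite sums can be exchanged. *)
transitivity (\sum_(m < k.+1) lowermul A B k m *m X m l).
  under [RHS]eq_bigr do rewrite /lowermul mulmx_suml.
  rewrite exchange_big/=; apply: eq_bigr => j _.
  rewrite mulmx_sumr -(@big_ord_lower _ (fun m => A k j *m (B j m *m X m l)) _ k).
  - by apply: eq_bigr => m _; rewrite mulmxA.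
  - by rewrite -ltnS.
  - by move=> m jm; rewrite Blow// mul0mx mulmx0.
rewrite big_ord_recr/= big1 ?add0r => [|m _]; rewrite AB.
  rewrite (_ : bmx1 R D k k = 1%:M) ?mul1mx//.
  by apply/matrixP => i j; rewrite !mxE eqxx.
rewrite (_ : bmx1 _ _ _ _ = 0) ?mul0mx//.
by apply/matrixP => i j; rewrite !mxE gtn_eqF.
Qed.

Lemma lowermul_diag {H} X k l : block_diagonal H ->
  lowermul H X k l = H k k *m X k l.
Proof.
move=> Hd; rewrite /lowermul big_ord_recr/= big1 ?add0r// => j _.
by rewrite Hd ?mul0mx// gtn_eqF.
Qed.

Lemma mulmx_adj m n p (A : 'M[R[i]]_(m, n)) (B : 'M[R[i]]_(n, p)) :
  (A *m B)^t* = (B^t*) *m (A^t*).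
Proof. by rewrite trmx_mul map_mxM. Qed.

Lemma badj_diag {H} : block_diagonal H -> block_diagonal (badj H).
Proof. by move=> Hd k l kl; rewrite /badj Hd 1?eq_sym// trmx0 map_mx0. Qed.

(** The adjoint of [A H B^*] is [B H^* A^*]. The sum stops at [l] on the left and at [k] on the
    right; both agree with the sum up to [maxn k l], as [A l j] vanishes for [j > l] and [B k j] for
    [j > k]. *)
Lemma badj_factorization {A H B} : block_lower A -> block_lower B ->
  block_diagonal H -> forall k l,
  badj (lowermul A (lowermul H (badj B))) k l =
  lowermul B (lowermul (badj H) (badj A)) k l.
Proof.
move=> Al Bl Hd k l.
have Hd' := badj_diag Hd.
have F j : (A l j *m lowermul H (badj B) j k)^t* =
    B k j *m lowermul (badj H) (badj A) j l.
  rewrite !lowermul_diag// !mulmx_adj -mulmxA; congr (_ *m _).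
  by apply/matrixP => a b; rewrite !mxE conjCK.
rewrite {1}/badj {1}/lowermul raddf_sum/= raddf_sum/=.
under eq_bigr do rewrite F.
pose F' j := B k j *m lowermul (badj H) (badj A) j l.
rewrite -(@big_ord_lower _ F' l (maxn k l)) ?leq_maxr//.
  by rewrite (@big_ord_lower _ F' k) ?leq_maxl// /F' => j kj; rewrite Bl// mul0mx.
by move=> j lj; rewrite /F' lowermul_diag// /badj Al// trmx0 map_mx0 !mulmx0.
Qed.

End BlockMatrices.

(** * Rows of the inverse factors as finite combinations of rows of G *)

Section Rows.
Context {R : realType} {D : nat}.
Implicit Types (A G H X : bmx R D) (v : bvec R D).

(** Left multiplication by [A] cancels [Ai], then the diagonal block of [H] is inverted. The form is
    generic because it is applied both to G and to its adjoint. *)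
Lemma gauss_borel_row {A Ai H X G} : lower_inverse A Ai ->
  block_diagonal H -> (forall k, H k k \in unitmx) ->
  (forall k l, G k l = lowermul Ai (lowermul H X) k l) ->
  forall k l, X k l = invmx (H k k) *m lowermul A G k l.
Proof.
move=> AAi Hd Hu GE k l.
rewrite /lowermul; under eq_bigr do rewrite GE.
by rewrite [X in _ *m X](lowermulK _ _ _ AAi) lowermul_diag// mulKmx.
Qed.

(** The second hypothesis makes [v] an eigenvector of [G] with eigenvalue [s]. Each row of [X]
    combines finitely many rows of [G], so only finite sums of series are interchanged. *)
Lemma abs_sum_mulv {A G X v} (U : forall k, 'M[R[i]]_(bsize D k)) (s : R[i]) :
  (forall k l, X k l = U k *m lowermul A G k l) ->
  (forall k i, abs_sum (mulv_term G v i) (s * v k i 0)) ->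
  forall k i, abs_sum (mulv_term X v i) (s * (U k *m lowermulv A v k) i 0).
Proof.
move=> XE Gv k i.
have -> : mulv_term X v i = fun p => \sum_a U k i a *
    (\sum_(j < k.+1) \sum_b A k j a b * mulv_term G v b p).
  apply/funext => -[l r]; rewrite /mulv_term /= XE mxE mulr_suml.
  apply: eq_bigr => a _; rewrite -mulrA; congr (_ * _).
  rewrite summxE mulr_suml; apply: eq_bigr => j _.
  by rewrite mxE mulr_suml; apply: eq_bigr => b _; rewrite mulrA.
rewrite mxE mulr_sumr (eq_bigr (fun a => U k i a *
    (\sum_(j < k.+1) \sum_b A k j a b * (s * v j b 0)))).
  apply: abs_sum_sum => a; apply: abs_sumZ; apply: abs_sum_sum => j.
  by apply: abs_sum_sum => b; exact: abs_sumZ (Gv j b).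
move=> a _; rewrite mulrCA; congr (_ * _).
rewrite summxE mulr_sumr; apply: eq_bigr => j _.
by rewrite mxE mulr_sumr; apply: eq_bigr => b _; rewrite mulrCA.
Qed.

End Rows.

(** * Enumeration, translation and reflection of multi-indices *)

Section MultiIndexBijections.
Context {D : nat}.

Definition idx_sub (al be : D.-tuple int) : D.-tuple int :=
  [tuple tnth al a - tnth be a | a < D].

Lemma idx_subK al : involutive (idx_sub al).
Proof.
by move=> be; apply: eq_from_tnth => a; rewrite !tnth_mktuple subKr.
Qed.

Lemma idx_subl_bij al : bijective (idx_sub^~ al).
Proof.
exists (fun be => [tuple tnth be a + tnth al a | a < D]) => be;
  by apply: eq_from_tnth => a; rewrite !tnth_mktuple (subrK, addrK).
Qed.

Lemma longitude_bidx k (i : 'I_(bsize D k)) : longitude (bidx i) = k.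
Proof. by apply/eqP; rewrite -mem_block mem_tnth. Qed.

(** A multi-index determines its block by its longitude and its position by its index in that
    duplicate-free block. This turns series over block positions into series over all
    multi-indices. *)
Lemma bidx_bij :
  bijective (fun p : {l : nat & 'I_(bsize D l)} => bidx (tagged p)).
Proof.
have lt al : (index al (block D (longitude al)) < bsize D (longitude al))%N.
  by rewrite index_mem mem_block.
pose e' al := Tagged (fun l => 'I_(bsize D l)) (Ordinal (lt al)).
have e'K al : bidx (tagged (e' al)) = al.
  by rewrite /bidx (tnth_nth al) nth_index// mem_block.
(* Of the inverse image of [p], only its being mapped to the same multi-index is kept; it is then
   free enough to substitute the equality of block numbers. *)
exists e' => // p; move: (e' _) (e'K (bidx (tagged p))) => {e'K}e'.
case: p e' => [l i] [m j] /= ji.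
have ml : m = l by rewrite -(longitude_bidx m j) ji longitude_bidx.
subst m; congr existT; apply/val_inj/eqP => /=.
by move/eqP: ji; rewrite /bidx !(tnth_nth (bidx i)) nth_uniq ?uniq_block.
Qed.

End MultiIndexBijections.

(** * Monomials on the punctured space and on the torus *)

Section Monomials.
Context {R : realType} {D : nat}.
Implicit Types (z : 'rV[R[i]]_D) (al be : D.-tuple int).

Lemma monomial_zinv al z : monomial al (zinv z) = (monomial al z)^-1.
Proof.
by rewrite /monomial -prodfV; apply: eq_bigr => a _; rewrite mxE exprz_inv invr_expz.
Qed.

Lemma monomial_idx_sub al be z : (forall a, z 0 a != 0) ->
  monomial (idx_sub al be) z = monomial al z / monomial be z.
Proof.
move=> z0; rewrite /monomial -prodf_div; apply: eq_bigr => a _.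
by rewrite tnth_mktuple expfzDr// invr_expz.
Qed.

Lemma monomial_neq0 al z : (forall a, z 0 a != 0) -> monomial al z != 0.
Proof. by move=> z0; apply/prodf_neq0 => a _; rewrite expfz_neq0. Qed.

Lemma norm_torus_val (t : torus R D) a : `|torus_val t 0 a| = 1.
Proof. exact: (set_valP t). Qed.

Lemma monomial_torus_conj al (t : torus R D) :
  (monomial al (torus_val t))^* = monomial al (zinv (torus_val t)).
Proof.
rewrite /monomial rmorph_prod; apply: eq_bigr => a _.
rewrite mxE; have x1 : `|torus_val t 0 a| = 1 by exact: norm_torus_val.
(* On the unit circle, conjugation is inversion. *)
have <- : (torus_val t 0 a)^* = (torus_val t 0 a)^-1.
  by rewrite [RHS]invC_norm x1 expr1n invr1 mul1r.
case: (tnth al a) => n; first exact: rmorphXn.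
by rewrite !NegzE -!invr_expz fmorphV; congr (_^-1); exact: rmorphXn.
Qed.

Lemma torus_val_neq0 (t : torus R D) a : torus_val t 0 a != 0.
Proof. by rewrite -normr_eq0 norm_torus_val oner_neq0. Qed.

End Monomials.

(** * The vector chi(z) as an eigenvector of G and of its adjoint *)

Section MomentRows.
Context {R : realType} {D : nat} (mu : complex_measure (torus R D) R).
Implicit Type z : 'rV[R[i]]_D.

Lemma pi2X_neq0 : ((2 * pi)%:C ^+ D : R[i]) != 0.
Proof.
by rewrite expf_neq0// (inj_eq (@complexI R) _ 0) gt_eqF// mulr_gt0// pi_gt0.
Qed.

(** For al = [bidx i] and be = [bidx j], the integrand z^al conj(z^be) equals (z^-1)^(be - al) on
    the torus. *)
Lemma moment_fourier k l i j :
  moment mu k l i j = (2 * pi)%:C ^+ D * fourier mu (idx_sub (bidx j) (bidx i)).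
Proof.
rewrite mxE /fourier mulVKf ?pi2X_neq0//; congr (cm_int mu _).
apply/funext => t; rewrite mxE big_ord1 !mxE monomial_torus_conj.
rewrite monomial_idx_sub => [|a]; last by rewrite mxE invr_eq0 torus_val_neq0.
by rewrite [X in _ = _ / X]monomial_zinv invrK mulrC.
Qed.

Lemma abs_sum_moment_row z : (forall a, z 0 a != 0) ->
  abs_summable (fun al => fourier mu al * monomial al z) ->
  forall k i, abs_sum (mulv_term (moment mu) (chi z) i)
    ((2 * pi)%:C ^+ D * muhat mu z * chi z k i 0).
Proof.
move=> z0 muS k i.
have bij := bij_comp (idx_subl_bij (bidx i)) bidx_bij.
have := abs_sum_reindex _ _ _ bij (abs_summable_abs_sum _ muS).
(* The factor z^al restores the original term: z^al c_(be - al) z^(be - al) = c_(be - al) z^be. *)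
move/(abs_sumZ _ _ ((2 * pi)%:C ^+ D * monomial (bidx i) z)).
rewrite mulrAC mxE; congr (abs_sum _ _); apply/funext => p /=.
rewrite /mulv_term moment_fourier mxE monomial_idx_sub//.
by field; rewrite monomial_neq0.
Qed.

Lemma abs_sum_moment_adj_row z : (forall a, z 0 a != 0) ->
  abs_summable (fun al => fourier mu al * monomial al (zinv z)) ->
  forall k i, abs_sum (mulv_term (badj (moment mu)) (chi z) i)
    ((2 * pi)%:C ^+ D * muhat_conj mu (zinv z) * chi z k i 0).
Proof.
move=> z0 muS k i.
(* Conjugating the coefficients preserves the moduli of the terms. *)
have {}muS : abs_summable (fun al => (fourier mu al)^* * monomial al (zinv z)).
  move: muS; rewrite /abs_summable; congr summable; apply/funext => al.
  have normJ (x : R[i]) :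
      ComplexField.Normc.normc (x^*) = ComplexField.Normc.normc x.
    by apply: complexI; exact: norm_conjC.
  by rewrite !(ComplexField.Normc.normcM _ (monomial _ _)) normJ.
have bij := bij_comp (inv_bij (idx_subK (bidx i))) bidx_bij.
have := abs_sum_reindex _ _ _ bij (abs_summable_abs_sum _ muS).
(* The entry (al, be) of the adjoint is (2 pi)^D conj(c_(al - be)), and z^be = z^al (z^-1)^(al -
   be). *)
move/(abs_sumZ _ _ ((2 * pi)%:C ^+ D * monomial (bidx i) z)).
rewrite mulrAC mxE; congr (abs_sum _ _); apply/funext => p /=.
rewrite /mulv_term /badj [map_mx _ _ _ _]mxE [trmx _ _ _]mxE moment_fourier.
rewrite [chi _ _ _ _]mxE monomial_zinv monomial_idx_sub//.
rewrite [X in _ = X * _]rmorphM/=.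
rewrite (_ : ((2 * pi)%:C ^+ D)^* = (2 * pi)%:C ^+ D :> R[i]); last first.
  by rewrite conj_Creal ?rpredX// complex_real.
by field; rewrite !monomial_neq0.
Qed.

End MomentRows.

Theorem proposition2p10 (R : realType) (D : nat) (D_gt0 : (0 < D)%N)
    (mu : complex_measure (torus R D) R) (mu_qd : quasi_definite mu)
    (S Si H Sh Shi : bmx R D) (fact : gauss_borel mu S Si H Sh Shi) :
  let Phi z := lowermulv S (chi z) in
  let Phih z := lowermulv Sh (chi z) in
  let C z := mulv (badj Si) (chi z) in
  let Ch z := mulv (badj Shi) (chi z) in
  (forall z, conv_domain mu (zinv z) ->
     mulv_converges (badj Si) (chi z) /\
     forall k, C z k = (2 * pi)%:C ^+ D *:
       (muhat_conj mu (zinv z) *: (invmx ((H k k)^t*) *m Phih z k))) /\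
  (forall z, conv_domain mu z ->
     mulv_converges (badj Shi) (chi z) /\
     forall k, Ch z k = (2 * pi)%:C ^+ D *:
       (muhat mu z *: (invmx (H k k) *m Phi z k))).
Proof.
case: fact => -[_ SSi] [_ ShShi] [Hd Hu] GE /=.
have [Sil _ _] := SSi; have [Shil _ _] := ShShi.
have Hd' := badj_diag Hd.
have Hu' k : badj H k k \in unitmx by rewrite map_unitmx unitmx_tr.
(* The adjoint of G factors in the same shape, with the two triangular factors exchanged and [H]
   replaced by its adjoint; this yields the formula for [C]. *)
have GE' k l : badj (moment mu) k l =
    lowermul Shi (lowermul (badj H) (badj Si)) k l.
  by rewrite -badj_factorization// /badj GE.
have XE := gauss_borel_row SSi Hd Hu GE.
have XE' := gauss_borel_row ShShi Hd' Hu' GE'.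
split=> z /interior_subset[z0 muS].
  have z0' a : z 0 a != 0 by have := z0 a; rewrite mxE invr_eq0.
  have sumE := abs_sum_mulv _ _ XE' (abs_sum_moment_adj_row mu z z0' muS).
  split=> [k i|k]; first by have [] := sumE k i.
  apply/colP => i; rewrite mxE (abs_sum_series _ _ (sumE k i)).
  by rewrite scalerA [RHS]mxE.
have sumE := abs_sum_mulv _ _ XE (abs_sum_moment_row mu z z0 muS).
split=> [k i|k]; first by have [] := sumE k i.
apply/colP => i; rewrite mxE (abs_sum_series _ _ (sumE k i)).
by rewrite scalerA [RHS]mxE.
Qed.
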